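(* Let $n\geq 3$ be an integer. Then there exists a constant $C(n)>0$, depending only on $n$, such that for every positive integer $T$ and every real $D>0$, $$\mathrm{Prob}\left(\frac{\mathrm{F}(a)}{(a_1 a_2\cdots a_n)^{\frac{1}{n-1}}}\geq D\right)\leq C(n)\, D^{-2\frac{n-1}{n+1}},$$ where $\mathrm{Prob}$ is with respect to the uniform distribution of $a=(a_1,\dots,a_n)$ on $G(T)$.
   Context: For an integer vector $a=(a_1,\dots,a_n)\in\mathbb{Z}_{>0}^n$ with $\gcd(a_1,\dots,a_n)=1$, the Frobenius number of $a$ is $\mathrm{F}(a)=\max\{b\in\mathbb{Z} : b\neq \langle a,z\rangle \text{ for all } z\in\mathbb{Z}_{\geq 0}^n\}$, where $\langle\cdot,\cdot\rangle$ is the standard inner product; i.e. $\mathrm{F}(a)$ is the largest integer that is not a non-negative integral combination of $a_1,\dots,a_n$ (it can be negative: it equals $-1$ if some $a_i=1$). For a positive integer $T$, $G(T)=\{a\in\mathbb{Z}_{>0}^n : \gcd(a_1,\dots,a_n)=1,\ \max_i a_i\leq T\}$, a finite nonempty set. $\mathrm{Prob}$ is the uniform probability measure on $G(T)$: the probability of an event is the number of $a\in G(T)$ satisfying it divided by $\#G(T)$. *)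

(* Defs.v *)
From HB Require Import structures.
From mathcomp Require Import all_boot all_order all_algebra.
From mathcomp Require Import all_classical all_reals all_analysis.

Set Implicit Arguments.
Unset Strict Implicit.
Unset Printing Implicit Defensive.

Import Order.TTheory GRing.Theory Num.Theory.
Local Open Scope ring_scope.

Definition gcd_vec (n : nat) (a : 'I_n -> nat) : nat :=
  \big[gcdn/0%N]_(i < n) a i.

Definition nonrepresentable (n : nat) (a : 'I_n -> nat) : set int :=
  [set b | forall z : 'I_n -> nat, b <> \sum_(i < n) (a i)%:Z * (z i)%:Z]%classic.

(* The maximum exists, and hence the default value 0 is not used, as soon as
   the entries are positive and coprime: see [frobenius_numberP]. *)
Definition frobenius_number (n : nat) (a : 'I_n -> nat) : int :=
  xget 0 (nonrepresentable a `&` ubound (nonrepresentable a))%classic.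

(* The entries of a vector of G(T) are at most T, so these vectors are encoded
   in the finite type of functions from 'I_n to {0, ..., T}. *)
Definition G (n T : nat) : {set {ffun 'I_n -> 'I_T.+1}} :=
  [set a : {ffun 'I_n -> 'I_T.+1} |
    [forall i, (0 < a i)%N] && (gcd_vec (fun i => a i) == 1%N)].

Definition Prob (R : realType) (n T : nat)
    (E : pred {ffun 'I_n -> 'I_T.+1}) : R :=
  #|[set a in G n T | E a]|%:R / #|G n T|%:R.

Lemma gcd_vec_comb (n : nat) (a : 'I_n -> nat) :
  exists c : 'I_n -> int, \sum_(i < n) (a i)%:Z * c i = (gcd_vec a)%:Z.
Proof.
rewrite /gcd_vec.
apply: (big_ind (fun x : nat => exists c : 'I_n -> int,
  \sum_(i < n) (a i)%:Z * c i = x%:Z)).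
- by exists (fun=> 0); rewrite big1 // => i _; rewrite mulr0.
- move=> x y [c Hc] [d Hd]; have [u [v Huv]] := Bezoutz x%:Z y%:Z.
  exists (fun i => u * c i + v * d i).
  have -> : (gcdn x y)%:Z = gcdz x y by [].
  rewrite -Huv -Hc -Hd !mulr_sumr -big_split /=.
  by apply: eq_bigr => i _; rewrite mulrDr !mulrA [_ * u]mulrC [_ * v]mulrC.
- move=> i _; exists (fun j => (j == i)%:R).
  rewrite (bigD1 i) //= eqxx mulr1 big1 ?addr0 // => j /negbTE ->.
  by rewrite mulr0.
Qed.

Lemma frobenius_numberP (n : nat) (a : 'I_n -> nat) :
  (forall i, (0 < a i)%N) -> gcd_vec a = 1%N ->
  (nonrepresentable a `&` ubound (nonrepresentable a))%classic
    (frobenius_number a).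
Proof.
move=> a_gt0 gcd1.
case: n a a_gt0 gcd1 => [|n] a a_gt0 gcd1; first by rewrite /gcd_vec big_ord0 in gcd1.
have [c] := gcd_vec_comb a; rewrite gcd1 => Hc.
set m : int := a ord0.
have m_gt0 : 0 < m by rewrite ltz_nat.
have m_neq0 : m != 0 by rewrite gt_eqF.
pose B : int := m * \sum_(i < n.+1) (a i)%:Z.
have B_ge0 : 0 <= B by rewrite mulr_ge0 ?sumr_ge0 ?ltW.
have large (b : int) : B <= b -> ~ nonrepresentable a b.
  move=> Bb; pose r i : int := ((c i * b) %% m)%Z; pose q i : int := ((c i * b) %/ m)%Z.
  have crq i : c i * b = q i * m + r i by exact: divz_eq.
  have r_ge0 i : 0 <= r i by rewrite modz_ge0.
  pose s : int := \sum_(i < n.+1) (a i)%:Z * q i.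
  have bE : b = \sum_(i < n.+1) (a i)%:Z * r i + m * s.
    rewrite -[LHS]mul1r -[1]/(1%N%:Z) -Hc mulr_suml /s mulr_sumr -big_split /=.
    apply: eq_bigr => i _.
    by rewrite -mulrA crq mulrDr addrC [q i * m]mulrC mulrCA.
  have s_ge0 : 0 <= s.
    rewrite -(pmulr_rge0 _ m_gt0) -(lerD2l (\sum_(i < n.+1) (a i)%:Z * r i)) -bE addr0.
    apply: le_trans Bb; rewrite /B mulr_sumr; apply: ler_sum => i _.
    by rewrite mulrC ler_wpM2r // ltW // ltz_pmod.
  move=> nb.
  apply: (nb (fun i => `|(r i + (i == ord0)%:R * s)%R|%N)).
  rewrite [LHS]bE.
  transitivity (\sum_(i < n.+1)
      ((a i)%:Z * r i + (a i)%:Z * ((i == ord0)%:R * s))); last first.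
    apply: eq_bigr => i _.
    by rewrite gez0_abs ?mulrDr // addr_ge0 // mulr_ge0 // ler0n.
  rewrite big_split /=; congr (_ + _).
  rewrite [RHS](bigD1 ord0) //= mul1r big1 ?addr0 // => i /negbTE ->.
  by rewrite mul0r mulr0.
pose P k := `[< nonrepresentable a (B - k%:Z) >].
have exP : exists k, P k.
  exists `|(B + 1)%R|%N; apply/asboolP => z; rewrite gez0_abs ?addr_ge0 //.
  rewrite opprD addrA subrr sub0r => /eqP; apply/negP.
  by rewrite lt_eqF // (@lt_le_trans _ _ 0) // sumr_ge0 // => i _; rewrite mulr_ge0.
case: (ex_minnP exP) => k /asboolP Pk kmin.
rewrite /frobenius_number; case: xgetP => [? -> //|none].
exfalso; apply: (none (B - k%:Z)); split=> // b nb.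
rewrite leNgt; apply/negP => kb.
have [Bb|bB] := leP B b; first exact: (large b Bb nb).
have Bb_ge0 : 0 <= B - b by rewrite subr_ge0 ltW.
have /kmin : P `|(B - b)%R|%N.
  by apply/asboolP; rewrite gez0_abs // opprB addrC subrK.
by rewrite -lez_nat gez0_abs // leNgt ltrBlDr addrC -ltrBlDr kb.
Qed.

(* Main.v *)
Require Import Defs.
From HB Require Import structures.
From mathcomp Require Import all_boot all_order all_algebra.
From mathcomp Require Import all_classical all_reals all_analysis.
From mathcomp Require Import algC cyclotomic.
From mathcomp Require Import zify ring lra.

Set Implicit Arguments.
Unset Strict Implicit.
Unset Printing Implicit Defensive.

Import Order.TTheory GRing.Theory Num.Theory.
Local Open Scope ring_scope.

(** Put [N = n - 1], single out one entry [m = a j] of [a], and let [x] be the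
    vector of the residues mod [m] of the [N] other entries.  Suppose that every
    class mod [m] has the form [<x, z> - <x, z'>] with [z], [z'] in the box
    [{0, ..., K - 1}^N] ([covers]).  Adding the constant vector [(K, ..., K)] to
    [z - z'] writes every class with coefficients between 0 and [2 K], and a
    multiple of [m] makes up for the rest: every integer that is at least
    [2 K N max(a)] is representable ([covers_representable]).  So a vector with
    a large Frobenius number has a residue vector that fails to cover.

    Such residue vectors are rare.  Counting the pairs [(z, z')] that reach a
    given class with the characters of [Z/m], the frequency 0 gives the main
    term, so if some class is missed, then the other frequencies must cancel it:
    their energy is at least [K^(2N)] ([not_covers_energy]).  The average of the
    energy over all [x] is computed exactly by orthogonality.  What is special
    about coprime entries is that no frequency [t <> 0] has [t x = 0 mod m].
    Dropping from the average the pairs [(t, x)] with [t x = 0], which are the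
    ones whose contribution does not decay with [K], leaves for the proportion
    of coprime [x] that fail to cover the bound
    [sum_(0 < t < m) ((1/d + e)^N - (1/d)^N)], where [d] is the order of [t] in
    [Z/m] and [e <= min(1/K, d/K^2)] ([uncovered_density_le]).  Since there are
    at most [d] frequencies of order [d], and orders divide [m], this is
    [O((m/K^N)^beta)] with [beta = 2/(N + 2)] ([uncovered_density]).  This
    [beta] is the exponent for which [D^(- N beta)] is the claimed tail.

    To pass from residues to vectors, the vectors are grouped by the dyadic sizes
    [2^(k i) <= a i < 2^(k i + 1)], and [j] is chosen with [k j] minimal: then
    the other entries run over about one period mod [m] or more, and the
    proportion for residues controls the proportion in the cell
    ([card_cell_residues]).  With [V = prod_i 2^(k i)] and [K] close to
    [D V^(1/N) / (2 N T)], a cell has [O(D^(- N beta) V (T^n/V)^beta)] vectors in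
    the tail ([card_cell_tail]).  As [beta <= 1/2], these bounds sum over the
    cells like a geometric series, to [O(D^(- N beta) T^n)] ([card_tail_le]),
    while [G(T)] has at least [T^n / 2] elements ([card_G_ge]). *)

(** * Additive characters and covering boxes *)

Definition dot (N : nat) (x z : 'I_N -> nat) : nat := \sum_(i < N) x i * z i.

Definition covers (m K N : nat) (x : 'I_N -> nat) : bool :=
  [forall r : 'I_m, [exists z : {ffun 'I_N -> 'I_K},
    [exists z' : {ffun 'I_N -> 'I_K},
      dot x (fun i => z i) == r + dot x (fun i => z' i) %[mod m]]]]%N.

Definition expsum (zeta : algC) (K t : nat) : algC :=
  \sum_(z < K) zeta ^+ (t * z).

(** The phase of the difference [u - v], written as a product so that the
    exponents stay natural numbers. *)
Definition phase (zeta : algC) (u v : nat) : algC :=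
  zeta ^+ u * (zeta ^+ v)^*.

Lemma norm_prim_root (m : nat) (zeta : algC) :
  m.-primitive_root zeta -> `|zeta| = 1.
Proof.
move=> prim; have m_gt0 := prim_order_gt0 prim.
apply/eqP; rewrite -(pexpr_eq1 m_gt0 (normr_ge0 _)) -normrX.
by rewrite prim_expr_order // normr1.
Qed.

Lemma conj_prim_root (m : nat) (zeta : algC) (k : nat) :
  m.-primitive_root zeta -> (zeta ^+ k)^* = zeta ^- k.
Proof.
move=> prim.
by rewrite invC_norm normrX (norm_prim_root prim) !expr1n invr1 mul1r.
Qed.

(** Orthogonality of characters: the phase is an [m]-th root of unity, so its
    geometric sum vanishes unless the phase is 1, that is unless [u = v] mod
    [m]. *)
Lemma sum_phase (m : nat) (zeta : algC) (u v : nat) :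
  m.-primitive_root zeta ->
  \sum_(j < m) phase zeta u v ^+ j = (m * (u == v %[mod m]))%:R.
Proof.
move=> prim; have m_gt0 := prim_order_gt0 prim.
have unit_v : zeta ^+ v != 0.
  apply: expf_neq0; apply: contra_eq_neq (prim_expr_order prim) => ->.
  by rewrite expr0n gtn_eqF // eq_sym oner_neq0.
have phase1 : (phase zeta u v == 1) = (u == v %[mod m]).
  by rewrite /phase (conj_prim_root _ prim) -(eq_prim_root_expr prim)
     -subr_eq0 -[X in _ - X](divff unit_v) -mulrBl mulf_eq0 invr_eq0
     (negbTE unit_v) orbF subr_eq0.
have phase_m : phase zeta u v ^+ m = 1.
  rewrite /phase (conj_prim_root _ prim) exprMn exprVn -!exprM.
  by rewrite mulnC exprM [(v * m)%N]mulnC exprM (prim_expr_order prim) !expr1n divr1.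
rewrite -phase1; case: eqVneq => [->|ph_neq1].
  by rewrite (eq_bigr (fun=> 1)) ?sumr_const ?card_ord ?muln1 // => j _; rewrite expr1n.
rewrite muln0; apply/eqP; have /eqP := subrX1 (phase zeta u v) m.
by rewrite phase_m subrr eq_sym mulf_eq0 subr_eq0 (negbTE ph_neq1).
Qed.

Lemma prod_expsum (K N : nat) (zeta : algC) (x : 'I_N -> nat) (j : nat) :
  \prod_(i < N) expsum zeta K (j * x i)
  = \sum_(z : {ffun 'I_N -> 'I_K}) (zeta ^+ dot x (fun i => z i)) ^+ j.
Proof.
rewrite /expsum bigA_distr_bigA; apply: eq_bigr => z _.
rewrite -exprM mulnC /dot big_distrr expr_sum /=.
by apply: eq_bigr => i _; rewrite mulnA.
Qed.

(** The product over the coordinates is the squared modulus of the exponential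
    sum over the whole box, hence a sum over pairs of points of the box; the
    frequency [j] enters as a power, ready for orthogonality in [j]. *)
Lemma prod_norm_expsum (K N : nat) (zeta : algC) (x : 'I_N -> nat) (j : nat) :
  \prod_(i < N) `|expsum zeta K (j * x i)| ^+ 2
  = \sum_(z : {ffun 'I_N -> 'I_K}) \sum_(z' : {ffun 'I_N -> 'I_K})
      phase zeta (dot x (fun i => z i)) (dot x (fun i => z' i)) ^+ j.
Proof.
rewrite prodrXl -normr_prod prod_expsum // normCK rmorph_sum big_distrl.
apply: eq_bigr => z _ /=; rewrite big_distrr /=; apply: eq_bigr => z' _.
by rewrite /phase exprMn rmorphXn.
Qed.

Lemma norm_expsum_dvd (m K : nat) (zeta : algC) (t : nat) :
  m.-primitive_root zeta -> (m %| t)%N -> `|expsum zeta K t| ^+ 2 = (K ^ 2)%:R.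
Proof.
move=> prim /dvdnP[q ->]; rewrite /expsum (eq_bigr (fun=> 1)).
  by rewrite sumr_const card_ord normr_nat natrX.
by move=> z _; rewrite mulnAC mulnC exprM (prim_expr_order prim) expr1n.
Qed.

(** If the class [r] is missed, then the sum over all frequencies, twisted by
    the conjugate of [zeta ^+ (j r)], counts [m] times the pairs that reach
    [r], so it is 0. Its term at [j = 0] is [K^(2N)], which the others must
    cancel. *)
Lemma not_covers_energy (m K N : nat) (zeta : algC) (x : 'I_N -> nat) :
  m.-primitive_root zeta -> ~~ covers m K x ->
  ((K ^ 2) ^ N)%:R <=
    \sum_(j < m | (0 < j)%N) \prod_(i < N) `|expsum zeta K (j * x i)| ^+ 2.
Proof.
move=> prim; have m_gt0 := prim_order_gt0 prim.
rewrite negb_forall => /existsP[r].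
rewrite negb_exists => /forallP nocover.
pose w (j : nat) : algC := ((zeta ^+ r)^* ) ^+ j.
have w_norm j : `|w j| = 1.
  by rewrite normrX norm_conjC normrX (norm_prim_root prim) !expr1n.
pose P (j : nat) : algC := \prod_(i < N) `|expsum zeta K (j * x i)| ^+ 2.
have P_ge0 j : 0 <= P j by apply: prodr_ge0 => i _; rewrite exprn_ge0.
(* Twisting by [w] moves the condition of [sum_phase] from the class 0 to the
   missed class [r]. *)
have twisted0 : \sum_(j < m) w j * P j = 0.
  under eq_bigr => j _.
    rewrite /P prod_norm_expsum /w big_distrr /=.
    under eq_bigr => z _.
      rewrite big_distrr /=.
      under eq_bigr => z' _.
        rewrite -exprMn /phase mulrCA -rmorphM -exprD -/(phase _ _ _).
        over.
      over.
    over.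
  rewrite exchange_big big1 // => z _; rewrite exchange_big big1 // => z' _.
  rewrite (sum_phase _ _ prim).
  have := nocover z; rewrite negb_exists => /forallP/(_ z')/negbTE ->.
  by rewrite muln0.
have P0 : P 0%N = ((K ^ 2) ^ N)%:R.
  rewrite /P (eq_bigr (fun=> (K ^ 2)%:R)) => [|i _].
    by rewrite prodr_const card_ord -natrX.
  by rewrite (norm_expsum_dvd _ prim).
rewrite -P0 -[P 0%N]ger0_norm //.
have -> : P 0%N = - \sum_(j < m | (0 < j)%N) w j * P j.
  apply/eqP; rewrite -addr_eq0 -[X in _ == X]twisted0.
  rewrite [X in _ == X](bigD1 (Ordinal m_gt0)) //= /w expr0 mul1r.
  by under [X in _ == _ + X]eq_bigl => j do rewrite -val_eqE /= -lt0n.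
rewrite normrN; apply: le_trans (ler_norm_sum _ _ _) _.
by apply: ler_sum => j _; rewrite normrM w_norm mul1r ger0_norm.
Qed.

(** * Counting residue vectors that fail to cover *)

(** Joint coprimality of [m] and the [x i], in the form needed on the Fourier
    side: no nonzero frequency kills every coordinate. *)
Definition primitive_mod (m N : nat) (x : 'I_N -> nat) : bool :=
  [forall j : 'I_m, (0 < j) ==> [exists i, ~~ (m %| j * x i)]]%N.

Definition uncovered (m K N : nat) : {set {ffun 'I_N -> 'I_m}} :=
  [set x : {ffun 'I_N -> 'I_m} |
    primitive_mod m (fun i => x i) && ~~ covers m K (fun i => x i)].

Definition annihilated (m j : nat) : nat := \sum_(x < m) (m %| j * x).

Definition collisions (m K j : nat) : nat :=
  \sum_(u < K) \sum_(v < K) (j * u == j * v %[mod m]).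

Lemma sum_norm_expsum (m K : nat) (zeta : algC) (j : nat) :
  m.-primitive_root zeta ->
  \sum_(x < m) `|expsum zeta K (j * x)| ^+ 2 = (m * collisions m K j)%:R.
Proof.
move=> prim.
have powA x c : zeta ^+ (j * x * c) = (zeta ^+ (j * c)) ^+ x.
  by rewrite mulnAC exprM.
under eq_bigr => x _.
  rewrite normCK rmorph_sum big_distrl /=.
  under eq_bigr => u _.
    rewrite big_distrr /=.
    under eq_bigr => v _.
      rewrite !powA rmorphXn -exprMn -/(phase _ _ _).
      over.
    over.
  over.
rewrite exchange_big /collisions big_distrr natr_sum; apply: eq_bigr => u _ /=.
rewrite exchange_big big_distrr natr_sum; apply: eq_bigr => v _ /=.
exact: sum_phase.
Qed.

(** Double counting of the energy over all residue vectors. The first sum is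
    the contribution of the pairs of a frequency and a vector that it
    annihilates; such a vector is not [primitive_mod], so this contribution is
    disjoint from the energy of [uncovered], and removing it is what lets the
    bound decay. *)
Lemma card_uncovered_le (m K N : nat) : (0 < m)%N ->
  (#|uncovered m K N| * (K ^ 2) ^ N
     + \sum_(j < m | 0 < j) (annihilated m j * K ^ 2) ^ N
   <= \sum_(j < m | 0 < j) (m * collisions m K j) ^ N)%N.
Proof.
move=> m_gt0; have [zeta prim] := C_prim_root_exists m_gt0.
rewrite -(ler_nat algC).
have -> : (\sum_(j < m | 0 < j) (m * collisions m K j) ^ N)%N%:R
    = \sum_(x : {ffun 'I_N -> 'I_m}) \sum_(j < m | (0 < j)%N)
        \prod_(i < N) `|expsum zeta K (j * x i)| ^+ 2.
  rewrite exchange_big natr_sum; apply: eq_bigr => j _ /=.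
  rewrite -(bigA_distr_bigA (fun _ x => `|expsum zeta K (j * nat_of_ord x)| ^+ 2)).
  by rewrite prodr_const card_ord (sum_norm_expsum _ _ prim) natrX.
have -> : (#|uncovered m K N| * (K ^ 2) ^ N
     + \sum_(j < m | 0 < j) (annihilated m j * K ^ 2) ^ N)%N%:R
    = \sum_(x : {ffun 'I_N -> 'I_m}) ((x \in uncovered m K N) * (K ^ 2) ^ N
        + \sum_(j < m | 0 < j) \prod_(i < N) ((m %| j * x i) * K ^ 2))%N%:R :> algC.
  rewrite -natr_sum; congr (_%:R); rewrite big_split /=; congr addn.
    by rewrite -big_distrl /= -sum1_card big_mkcond.
  rewrite exchange_big; apply: eq_bigr => j _ /=.
  rewrite -(bigA_distr_bigA (fun _ x => (m %| j * nat_of_ord x) * K ^ 2)%N).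
  by rewrite prod_nat_const card_ord -big_distrl.
apply: ler_sum => x _; have [xU | xU] := boolP (x \in uncovered m K N).
  move: xU; rewrite inE => /andP[/forallP x_prim x_unc].
  rewrite mul1n [X in (_ + X)%N]big1 ?addn0.
    exact: (not_covers_energy prim x_unc).
  move=> j j_gt0; have /implyP/(_ j_gt0)/existsP[i ndvd] := x_prim j.
  by rewrite (bigD1 i) //= (negbTE ndvd).
rewrite mul0n add0n natr_sum; apply: ler_sum => j _.
rewrite natr_prod; apply: ler_prod => i _; rewrite ler0n /=.
have [dvd | _] := boolP (m %| _)%N; last by rewrite mul0n exprn_ge0.
by rewrite mul1n (norm_expsum_dvd _ prim).
Qed.

(** * Collisions and annihilators in terms of additive orders *)

Lemma count_residue (d K r : nat) : (r < d)%N ->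
  (\sum_(v < K) (v %% d == r) = (K + (d.-1 - r)) %/ d)%N.
Proof.
move=> r_lt_d; have d_gt0 : (0 < d)%N by apply: leq_ltn_trans r_lt_d.
elim: K => [|K IHK]; first by rewrite big_ord0 divn_small //; lia.
rewrite big_ord_recr /= IHK addSn divnS // addnC; congr (nat_of_bool _ + _)%N.
have -> : (K + (d.-1 - r)).+1 = (K + d - r)%N by lia.
rewrite -eqn_mod_dvd; last by lia.
by rewrite modnDr (modn_small r_lt_d).
Qed.

Lemma count_multiples (m c : nat) : (0 < c)%N -> (c %| m)%N ->
  (\sum_(v < m) (c %| v) = m %/ c)%N.
Proof.
move=> c_gt0 /dvdnP[q ->]; rewrite -[LHS]/(\sum_(v < q * c) (v %% c == 0))%N.
rewrite count_residue // subn0 divnMDl // mulnK // divn_small ?addn0 //; lia.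
Qed.

(** The order of [j] in the additive group [Z/m]. *)
Definition add_order (m j : nat) : nat := m %/ gcdn j m.

Lemma add_orderP (m j x : nat) : (0 < m)%N ->
  (m %| j * x)%N = (add_order m j %| x)%N.
Proof.
move=> m_gt0; have g_gt0 : (0 < gcdn j m)%N by rewrite gcdn_gt0 m_gt0 orbT.
rewrite -[RHS](dvdn_pmul2r g_gt0) divnK ?dvdn_gcdr // muln_gcdr.
by rewrite dvdn_gcd (dvdn_mull x (dvdnn m)) andbT mulnC.
Qed.

Lemma add_order_dvd (m j : nat) : (add_order m j %| m)%N.
Proof. by apply/dvdnP; exists (gcdn j m); rewrite mulnC divnK // dvdn_gcdr. Qed.

Lemma add_order_gt0 (m j : nat) : (0 < m)%N -> (0 < add_order m j)%N.
Proof. by move=> m_gt0; apply: dvdn_gt0 (add_order_dvd m j). Qed.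

Lemma add_order_gt1 (m j : nat) : (0 < j < m)%N -> (1 < add_order m j)%N.
Proof.
move=> /andP[j_gt0 j_lt]; have m_gt0 : (0 < m)%N by apply: leq_ltn_trans j_lt.
rewrite ltn_neqAle eq_sym add_order_gt0 // andbT; apply/eqP => ord1.
have := add_orderP j 1 m_gt0; rewrite ord1 dvdnn muln1 => /(dvdn_leq j_gt0).
by rewrite leqNgt j_lt.
Qed.

Lemma annihilatedE (m j : nat) : (0 < m)%N ->
  (annihilated m j = m %/ add_order m j)%N.
Proof.
move=> m_gt0; rewrite -(count_multiples (add_order_gt0 j m_gt0)) ?add_order_dvd //.
by apply: eq_bigr => x _; rewrite add_orderP.
Qed.

Lemma collisionsE (m K j : nat) : (0 < m)%N ->
  (collisions m K j = \sum_(u < K) \sum_(v < K) (u == v %[mod add_order m j]))%N.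
Proof.
move=> m_gt0; apply: eq_bigr => u _; apply: eq_bigr => v _; congr nat_of_bool.
wlog le_vu : u v / (v <= u)%N => [hwlog|].
  have [le_vu | /ltnW le_uv] := leqP v u; first exact: hwlog.
  by rewrite eq_sym hwlog // eq_sym.
by rewrite !eqn_mod_dvd ?leq_mul2l ?le_vu ?orbT // -mulnBr add_orderP.
Qed.

(** For each [u], at most [K/d + 1] values of [v] collide with it. *)
Lemma collisions_leK (m K j : nat) : (0 < m)%N ->
  (add_order m j * collisions m K j <= K * (K + add_order m j))%N.
Proof.
move=> m_gt0; rewrite collisionsE //; set d := add_order m j.
have d_gt0 : (0 < d)%N by apply: add_order_gt0.
rewrite big_distrr -[X in (_ <= X * _)%N]card_ord -sum_nat_const.
apply: leq_sum => u _ /=; under eq_bigr => v _ do rewrite eq_sym.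
rewrite count_residue ?ltn_mod // mulnC.
by apply: leq_trans (leq_trunc_div _ _) _; lia.
Qed.

(** The counts [c r] of the residues mod [d] in [{0, ..., K - 1}] have mean
    [K/d] and deviate from it by at most 1, so the sum of their squares
    exceeds [K^2/d] by at most [d]. For small orders [d] this is much better
    than [collisions_leK], and gives the tail exponents that exceed 1. *)
Lemma collisions_led (m K j : nat) : (0 < m)%N ->
  (add_order m j * collisions m K j <= K ^ 2 + add_order m j ^ 2)%N.
Proof.
move=> m_gt0; rewrite collisionsE //; set d := add_order m j.
have d_gt0 : (0 < d)%N by apply: add_order_gt0.
pose c (r : 'I_d) := (\sum_(v < K) (v %% d == r))%N.
have sum_residues (v : nat) : (\sum_(r < d) (v %% d == r) = 1)%N.
  rewrite (bigD1 (Ordinal (ltn_pmod v d_gt0))) //= eqxx big1 // => r.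
  by rewrite -val_eqE /= eq_sym => /negbTE ->.
have sum_c : (\sum_r c r = K)%N.
  rewrite exchange_big (eq_bigr (fun=> 1%N)) ?sum1_card ?card_ord // .
have -> : (\sum_(u < K) \sum_(v < K) (u == v %[mod d]) = \sum_r c r ^ 2)%N.
  under [RHS]eq_bigr => r _ do rewrite -mulnn big_distrlr /=.
  rewrite [RHS]exchange_big; apply: eq_bigr => u _ /=.
  rewrite [RHS]exchange_big; apply: eq_bigr => v _ /=.
  rewrite -[LHS]muln1 -(sum_residues u) big_distrr; apply: eq_bigr => r _ /=.
  by case: (eqVneq (u %% d)%N r) => [->|]; rewrite ?muln1 ?muln0 //= mul1n eq_sym.
(* Scaling by [d] keeps the variance argument in the integers. *)
have dev r : (d%:Z * (c r)%:Z - K%:Z) ^+ 2 <= d%:Z ^+ 2.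
  have lower : (K <= d * c r + d)%N.
    rewrite /c count_residue //; have := ltn_ceil (K + (d.-1 - r)) d_gt0; lia.
  have upper : (d * c r <= K + d)%N.
    rewrite /c count_residue //; have := leq_trunc_div (K + (d.-1 - r)) d; lia.
  by rewrite -subr_ge0 subr_sqr mulr_ge0; lia.
have : \sum_r (d%:Z * (c r)%:Z - K%:Z) ^+ 2 <= \sum_(r < d) d%:Z ^+ 2.
  by apply: ler_sum => r _; apply: dev.
have -> : \sum_r (d%:Z * (c r)%:Z - K%:Z) ^+ 2
    = d%:Z ^+ 2 * (\sum_r c r ^ 2)%N%:Z - d%:Z * K%:Z ^+ 2.
  rewrite (eq_bigr (fun r => d%:Z ^+ 2 * ((c r) ^ 2)%N%:Z
    + ((- (2%:Z * d%:Z * K%:Z)) * (c r)%:Z + K%:Z ^+ 2))); last first.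
    by move=> r _; rewrite PoszM; ring.
  rewrite big_split big_split /= -!mulr_sumr sumr_const card_ord.
  rewrite -!(big_morph Posz PoszD (erefl _)) sum_c -mulr_natr natz; ring.
rewrite sumr_const card_ord -mulr_natr natz => ineq.
rewrite -lez_nat -(ler_pM2l (_ : 0 < d%:Z)) ?ltz_nat //.
rewrite !PoszD !PoszM; move: ineq; set s := Posz _; nia.
Qed.

(** * Sums over divisors and over orders *)

(** Divisors above the square root are matched by [d |-> m/d] with divisors
    below it. *)
Lemma card_divisors_sqr (m : nat) : (0 < m)%N ->
  ((\sum_(d < m.+1 | d %| m) 1) ^ 2 <= 4 * m)%N.
Proof.
move=> m_gt0.
have [s s_sqr s_max] : {s | s * s <= m & m < s.+1 * s.+1}%N.
  have ex0 : exists s, (s * s <= m)%N by exists 0%N.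
  have bounded s : (s * s <= m)%N -> (s <= m)%N by nia.
  case: (ex_maxnP ex0 bounded) => s s_sqr s_max; exists s => //.
  by rewrite ltnNge; apply/negP => /s_max; rewrite ltnn.
pose small := [set d : 'I_m.+1 | (d %| m) && (d <= s)]%N.
pose large := [set d : 'I_m.+1 | (d %| m) && (s < d)]%N.
have small_le : (#|small| <= s)%N.
  have sub : small \subset [set (inord i.+1 : 'I_m.+1) | i : 'I_s].
    apply/fintype.subsetP => d; rewrite inE => /andP[d_dvd d_le].
    have d_gt0 := dvdn_gt0 m_gt0 d_dvd.
    have lt_s : (d.-1 < s)%N by lia.
    apply/imsetP; exists (Ordinal lt_s) => //=; apply: val_inj => /=.
    by rewrite prednK // inordK.
  apply: leq_trans (subset_leq_card sub) _.
  by apply: leq_trans (leq_imset_card _ _) _; rewrite card_ord.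
have large_le : (#|large| <= #|small|)%N.
  pose f (d : 'I_m.+1) : 'I_m.+1 := inord (m %/ d).
  have fE d : f d = (m %/ d)%N :> nat by rewrite inordK // ltnS leq_div.
  rewrite -(card_in_imset (f := f)).
    apply/subset_leq_card/fintype.subsetP => _ /imsetP[d + ->].
    rewrite !inE fE => /andP[/dvdnP[q mE] s_lt].
    have -> : (m %/ d = q)%N by rewrite [X in (X %/ _)%N]mE mulnK; lia.
    by apply/andP; split; [apply/dvdnP; exists d; rewrite mulnC | nia].
  move=> d d'; rewrite !inE => /andP[/dvdnP[q mE] s_lt] /andP[/dvdnP[q' mE'] s_lt'].
  move=> /(congr1 (@nat_of_ord _)); rewrite !fE => eq_q; apply: val_inj => /=.
  have : (m %/ d = q)%N by rewrite [X in (X %/ _)%N]mE mulnK; lia.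
  have : (m %/ d' = q')%N by rewrite [X in (X %/ _)%N]mE' mulnK; lia.
  move=> q'E qE; have qq : q' = q by lia.
  rewrite qq in mE'; have q_gt0 : (0 < q)%N by move: mE m_gt0; case: (q); lia.
  by apply/eqP; rewrite -(eqn_pmul2l q_gt0); lia.
have -> : (\sum_(d < m.+1 | d %| m) 1 = #|small| + #|large|)%N.
  rewrite -!sum1_card (bigID (fun d : 'I_m.+1 => d <= s)%N) /=; congr addn.
    by apply: eq_bigl => d; rewrite inE.
  by apply: eq_bigl => d; rewrite inE -ltnNge.
nia.
Qed.

(** The elements of order [d] in [Z/m] are multiples of [m/d], and there are
    [d] of these. *)
Lemma sum_add_order_le (R : realFieldType) (m : nat) (h : nat -> R) :
  (0 < m)%N -> (forall d, 0 <= h d) ->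
  \sum_(j < m | (0 < j)%N) h (add_order m j)
  <= \sum_(d < m.+1 | (1 < d)%N && (d %| m)%N) d%:R * h d.
Proof.
move=> m_gt0 h_ge0.
pose ord (j : 'I_m) : 'I_m.+1 := inord (add_order m j).
have ordE j : ord j = add_order m j :> nat.
  by rewrite inordK // ltnS dvdn_leq // add_order_dvd.
rewrite (partition_big ord (fun d : 'I_m.+1 => (1 < d)%N && (d %| m)%N)) /=; last first.
  by move=> j j_gt0; rewrite ordE add_order_dvd add_order_gt1 // j_gt0 /=.
apply: ler_sum => d /andP[d_gt1 d_dvd].
have d_gt0 : (0 < d)%N by apply: ltnW.
have c_gt0 : (0 < m %/ d)%N by rewrite divn_gt0 // dvdn_leq.
have c_dvd : (m %/ d %| m)%N by apply/dvdnP; exists d; rewrite mulnC divnK.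
apply: (@le_trans _ _ (\sum_(j < m | (m %/ d %| j)%N) h d)).
  rewrite big_mkcond [leRHS]big_mkcond; apply: ler_sum => j _.
  case: (boolP ((0 < j)%N && _)) => [/andP[_ /eqP dE]|_]; last by case: ifP.
  have -> : add_order m j = d by rewrite -dE ordE.
  rewrite ifT // -dE ordE /add_order divnA ?dvdn_gcdr // mulKn //.
  exact: dvdn_gcdl.
rewrite sumr_const -sum1_card big_mkcond /=.
rewrite -[h d *+ _]mulr_natl ler_wpM2r // ler_nat.
have -> : (\sum_(i < m) (if i \in [pred j : 'I_m | m %/ d %| j] then 1 else 0)
  = \sum_(i < m) (m %/ d %| i))%N.
  by apply: eq_bigr => i _; rewrite inE; case: (_ %| _)%N.
by rewrite count_multiples // -[X in (X %/ _)%N](divnK d_dvd) mulKn.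
Qed.

(** The two terms on the right correspond to the cases [e <= b], where the
    first order term of the binomial expansion dominates, and [b < e], where
    the last one does. *)
Lemma expr_add_diff (R : realFieldType) (b e : R) (N : nat) : 0 <= b -> 0 <= e ->
  (b + e) ^+ N.+1 - b ^+ N.+1 <= 2 ^+ N.+1 * (e * b ^+ N + e ^+ N.+1).
Proof.
move=> b_ge0 e_ge0.
have [le_eb | lt_be] := leP e b.
  (* The [- 1] absorbs the term [e * b ^+ n.+1] of the induction step. *)
  have small n : (b + e) ^+ n.+1 - b ^+ n.+1 <= (2 ^+ n.+1 - 1) * (e * b ^+ n).
    elim: n => [|n IHn]; first by rewrite !expr1 expr0; lra.
    have pow_ge0 := exprn_ge0 n.+1 b_ge0; have pow'_ge0 := exprn_ge0 n b_ge0.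
    have -> : (b + e) ^+ n.+2 - b ^+ n.+2
        = (b + e) * ((b + e) ^+ n.+1 - b ^+ n.+1) + e * b ^+ n.+1.
      by rewrite ![_ ^+ n.+2]exprS; ring.
    apply: (@le_trans _ _ ((b + e) * ((2 ^+ n.+1 - 1) * (e * b ^+ n)) + e * b ^+ n.+1)).
      by rewrite lerD2r ler_wpM2l // addr_ge0.
    apply: (@le_trans _ _ ((2 * b) * ((2 ^+ n.+1 - 1) * (e * b ^+ n)) + e * b ^+ n.+1)).
      rewrite lerD2r ler_wpM2r //; last by lra.
      by rewrite mulr_ge0 ?mulr_ge0 // subr_ge0 exprn_ege1 // ler1n.
    rewrite [2 ^+ n.+2]exprS [b ^+ n.+1]exprS.
    by rewrite le_eqVlt; apply/orP; left; apply/eqP; ring.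
  apply: le_trans (small N) _; rewrite mulrDr.
  have := exprn_ge0 N.+1 e_ge0; have : 0 <= e * b ^+ N by rewrite mulr_ge0 ?exprn_ge0.
  have : 0 <= 2 ^+ N.+1 :> R by rewrite exprn_ge0.
  nra.
apply: (@le_trans _ _ ((2 * e) ^+ N.+1)).
  apply: (@le_trans _ _ ((b + e) ^+ N.+1)); first by rewrite gerBl exprn_ge0.
  by rewrite lerXn2r ?nnegrE //; lra.
by rewrite exprMn ler_wpM2l ?exprn_ge0 // lerDr mulr_ge0 ?exprn_ge0.
Qed.

(** * The density of residue vectors that fail to cover *)

(** A bound for the excess of the collision density [collisions / K^2] over
    its expected value [1/d]. *)
Definition excess (R : realFieldType) (K d : nat) : R :=
  Num.min K%:R^-1 (d%:R / K%:R ^+ 2).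

Lemma excess_ge0 (R : realFieldType) (K d : nat) : 0 <= excess R K d.
Proof. by rewrite le_min invr_ge0 ler0n divr_ge0 // exprn_ge0. Qed.

Lemma excess_leK (R : realFieldType) (K d : nat) : excess R K d <= K%:R^-1.
Proof. by rewrite ge_min lexx. Qed.

Lemma excess_led (R : realFieldType) (K d : nat) :
  excess R K d <= d%:R / K%:R ^+ 2.
Proof. by rewrite ge_min lexx orbT. Qed.

Lemma collisions_density (R : realFieldType) (m K j : nat) :
  (0 < m)%N -> (0 < K)%N ->
  (collisions m K j)%:R / K%:R ^+ 2
  <= (add_order m j)%:R^-1 + excess R K (add_order m j).
Proof.
move=> m_gt0 K_gt0; have := collisions_leK K j m_gt0.
have := collisions_led K j m_gt0; have := add_order_gt0 j m_gt0.
set d := add_order m j => d_gt0.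
rewrite -!(ler_nat R) !(natrM, natrD, natrX) => led leK.
have dR_gt0 : 0 < d%:R :> R by rewrite ltr0n.
have KR_gt0 : 0 < K%:R :> R by rewrite ltr0n.
rewrite -lerBlDl le_min !lerBlDl; apply/andP; split.
  rewrite ler_pdivrMr ?exprn_gt0 // -(ler_pM2l dR_gt0); apply: le_trans leK _.
  by rewrite le_eqVlt; apply/orP; left; apply/eqP; field; rewrite !gt_eqF.
rewrite ler_pdivrMr ?exprn_gt0 // -(ler_pM2l dR_gt0); apply: le_trans led _.
by rewrite le_eqVlt; apply/orP; left; apply/eqP; field; rewrite !gt_eqF.
Qed.

Lemma uncovered_density_le (R : realFieldType) (m K N : nat) :
  (0 < m)%N -> (0 < K)%N ->
  #|uncovered m K N|%:R / m%:R ^+ N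
  <= \sum_(j < m | (0 < j)%N)
       (((add_order m j)%:R^-1 + excess R K (add_order m j)) ^+ N
        - (add_order m j)%:R^-1 ^+ N).
Proof.
move=> m_gt0 K_gt0.
have mR_gt0 : 0 < m%:R :> R by rewrite ltr0n.
have KR_gt0 : 0 < K%:R :> R by rewrite ltr0n.
rewrite ler_pdivrMr ?exprn_gt0 // -(ler_pM2r (_ : 0 < (K%:R ^+ 2) ^+ N)); last first.
  by rewrite !exprn_gt0.
have := card_uncovered_le K N m_gt0.
rewrite -(ler_nat R) natrD natrM !natr_sum natrX (natrX _ K 2) -lerBrDr => /le_trans; apply.
rewrite -sumrB mulr_suml mulr_suml; apply: ler_sum => j _.
rewrite !(natrX, natrM) annihilatedE // -mulrA -exprMn mulrBl -!exprMn.
have -> : (m %/ add_order m j)%N%:R = (add_order m j)%:R^-1 * m%:R :> R.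
  by rewrite natf_div ?add_order_dvd // mulrC.
rewrite mulrA lerB // lerXn2r ?nnegrE ?mulr_ge0 ?addr_ge0 ?invr_ge0 //;
  rewrite ?excess_ge0 ?exprn_ge0 ?ler0n //.
  rewrite -mulrA mulrCA ler_wpM2l ?ler0n //.
  by rewrite -ler_pdivrMr ?exprn_gt0 // collisions_density.
by rewrite mulrA.
Qed.

(** Telescoping, from [1/d^2 <= 1/(d - 1) - 1/d]. *)
Lemma sum_inv_sqr_le (R : realFieldType) (n : nat) :
  \sum_(d < n.+1 | (1 < d)%N) d%:R^-1 ^+ 2 <= 1 :> R.
Proof.
case: n => [|n]; first by rewrite big_mkcond big_ord1 /= ler01.
(* The remainder of the telescoping sum makes the induction go through. *)
suff bound : \sum_(d < n.+2 | (1 < d)%N) d%:R^-1 ^+ 2 <= 1 - n.+1%:R^-1 :> R.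
  by apply: le_trans bound _; rewrite gerBl invr_ge0.
elim: n => [|n IHn].
  by rewrite big_mkcond !big_ord_recr big_ord0 /= !addr0 invr1 subrr.
rewrite big_mkcond big_ord_recr -big_mkcond /=.
apply: le_trans (lerD IHn (lexx _)) _.
have n_gt0 : 0 < n.+1%:R :> R by rewrite ltr0n.
rewrite [n.+2%:R]mulrSr; move: n_gt0; set t : R := n.+1%:R => t_gt0.
have t1_gt0 : 0 < t + 1 by rewrite addr_gt0.
have -> : 1 - (t + 1)^-1 = 1 - t^-1 + (t * (t + 1))^-1.
  by field; rewrite !gt_eqF.
rewrite lerD2l exprVn lef_pV2 ?posrE ?mulr_gt0 ?exprn_gt0 ?addr_gt0 //.
by rewrite expr2 ler_wpM2r ?lerDl // addr_ge0 // ltW.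
Qed.

(** The exponent [beta] for which [N * beta] is the exponent [2 (n - 1)/(n +
    1)] of the tail, with [n = N + 1]. *)
Definition tail_exponent (R : realType) (N : nat) : R := 2 / N.+2%:R.

Lemma tail_exponent_gt0 (R : realType) (N : nat) : 0 < tail_exponent R N.
Proof. by rewrite divr_gt0 ?ltr0n. Qed.

Lemma tail_exponent_le_half (R : realType) (N : nat) : (2 <= N)%N ->
  tail_exponent R N <= 2^-1.
Proof.
move=> N_ge2; rewrite ler_pdivrMr ?ltr0n //.
rewrite mulrC ler_pdivlMr ?ltr0n // -natrM ler_nat; lia.
Qed.

(** Up to [N.+1 = 4] each term is at most [K^(- (N + 1)/2)] and there are at
    most [2 sqrt m] divisors, so the sum is at most twice the square root of
    [m / K^(N + 1)]. Beyond that, each term is at most [1/(d K)^2] and the sum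
    converges. *)
Lemma divisor_sum_le (R : realType) (m K N : nat) :
  (0 < m)%N -> (0 < K)%N -> (0 < N)%N -> (m <= K ^ N.+1)%N ->
  \sum_(d < m.+1 | (1 < d)%N && (d %| m)%N)
      d%:R * (excess R K d * d%:R^-1 ^+ N)
  <= 2 * (m%:R / K%:R ^+ N.+1) `^ tail_exponent R N.+1.
Proof.
move=> m_gt0 K_gt0 N_gt0 m_le.
have mR_gt0 : 0 < m%:R :> R by rewrite ltr0n.
have KR_gt0 : 0 < K%:R :> R by rewrite ltr0n.
have v_gt0 : 0 < K%:R^-1 :> R by rewrite invr_gt0.
have v_le1 : K%:R^-1 <= 1 :> R by rewrite invf_le1 // ler1n.
have y_gt0 : 0 < m%:R / K%:R ^+ N.+1 :> R by rewrite divr_gt0 ?exprn_gt0.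
have y_le1 : m%:R / K%:R ^+ N.+1 <= 1 :> R.
  by rewrite ler_pdivrMr ?exprn_gt0 // mul1r -natrX ler_nat.
have [N_le3 | N_gt3] := leqP N 3.
  have term_le d : (1 < d)%N ->
      d%:R * (excess R K d * d%:R^-1 ^+ N) <= Num.sqrt (K%:R^-1 ^+ N.+1).
    move=> d_gt1; have d_gt0 : 0 < d%:R :> R by rewrite ltr0n ltnW.
    have e_ge0 := excess_ge0 R K d; have e_leK := excess_leK R K d.
    have := excess_led R K d; rewrite -exprVn.
    have u_gt0 : 0 < d%:R^-1 :> R by rewrite invr_gt0.
    have u_le1 : d%:R^-1 <= 1 :> R by rewrite invf_le1 // ler1n ltnW.
    have du : d%:R * d%:R^-1 = 1 :> R by rewrite divff // gt_eqF.
    move: d_gt0 u_gt0 u_le1 du v_gt0 v_le1 e_ge0 e_leK.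
    (* From here on [t = d], [u = 1/d], [v = 1/K] and [e <= min(v, t v^2)];
       the bound [e <= v] is best for [N.+1 = 2], [e <= t v^2] for
       [N.+1 = 4], and their product for [N.+1 = 3]. *)
    move: (K%:R^-1 : R) (d%:R : R) (d%:R^-1 : R) (excess R K d : R) => v t u e.
    move=> t_gt0 u_gt0 u_le1 tu v_gt0 v_le1 e_ge0 e_leK e_led.
    have lhs_ge0 : 0 <= t * (e * u ^+ N) by rewrite !mulr_ge0 ?exprn_ge0 // ltW.
    rewrite -[leLHS]ger0_norm // -sqrtr_sqr ler_sqrt; last by rewrite exprn_ge0 // ltW.
    have eu_led : e * u <= v ^+ 2.
      have : e * u <= t * v ^+ 2 * u by rewrite ler_wpM2r // ltW.
      by rewrite mulrAC tu mul1r.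
    have eu_ge0 : 0 <= e * u by rewrite mulr_ge0 // ltW.
    case: N N_gt0 N_le3 lhs_ge0 {m_le y_gt0 y_le1} => [//|[|[|[|//]]]] _ _ _.
    - have -> : t * (e * u ^+ 1) = e * (t * u) by ring.
      by rewrite tu mulr1 lerXn2r ?nnegrE // ltW.
    - have -> : t * (e * u ^+ 2) = e * u * (t * u) by ring.
      rewrite tu mulr1 expr2 [v ^+ 3]exprS.
      have -> : e * u * (e * u) = e * ((e * u) * u) by ring.
      rewrite ler_pM ?mulr_ge0 ?(ltW u_gt0) //.
      by rewrite -[leRHS]mulr1 ler_pM ?mulr_ge0 ?(ltW u_gt0).
    - have -> : t * (e * u ^+ 3) = e * u * u * (t * u) by ring.
      rewrite tu mulr1 (_ : v ^+ 4 = (v ^+ 2) ^+ 2); last by ring.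
      rewrite lerXn2r ?nnegrE ?mulr_ge0 ?(ltW u_gt0) ?exprn_ge0 ?(ltW v_gt0) //.
      by rewrite -[leRHS]mulr1 ler_pM ?mulr_ge0 ?(ltW u_gt0).
  apply: (@le_trans _ _ (\sum_(d < m.+1 | (d %| m)%N) Num.sqrt (K%:R^-1 ^+ N.+1))).
    rewrite big_mkcond [leRHS]big_mkcond; apply: ler_sum => d _.
    case: (boolP (_ && _)) => [/andP[d_gt1 ->]|_]; first exact: term_le.
    by case: ifP; rewrite ?sqrtr_ge0.
  have -> : \sum_(d < m.+1 | (d %| m)%N) Num.sqrt (K%:R^-1 ^+ N.+1)
     = (\sum_(d < m.+1 | d %| m) 1)%N%:R * Num.sqrt (K%:R^-1 ^+ N.+1) :> R.
    by rewrite natr_sum mulr_suml; apply: eq_bigr => d _; rewrite mul1r.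
  have tau_le : (\sum_(d < m.+1 | d %| m) 1)%N%:R <= 2 * Num.sqrt m%:R :> R.
    rewrite -[leLHS]ger0_norm // -sqrtr_sqr.
    have -> : 2 * Num.sqrt m%:R = Num.sqrt (4 * m%:R) :> R.
      rewrite sqrtrM // (_ : 4 = 2 ^+ 2) ?sqrtr_sqr ?ger0_norm //; ring.
    by rewrite ler_sqrt ?mulr_ge0 // -natrX -natrM ler_nat card_divisors_sqr.
  apply: (@le_trans _ _ (2 * Num.sqrt m%:R * Num.sqrt (K%:R^-1 ^+ N.+1))).
    by rewrite ler_wpM2r ?sqrtr_ge0.
  rewrite -mulrA ler_wpM2l // -sqrtrM // exprVn.
  rewrite -powR12_sqrt; last exact: ltW.
  by apply: ger_powR; rewrite ?y_gt0 ?tail_exponent_le_half.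
apply: (@le_trans _ _ (K%:R^-1 ^+ 2)).
  apply: (@le_trans _ _ (\sum_(d < m.+1 | (1 < d)%N) K%:R^-1 ^+ 2 * d%:R^-1 ^+ 2)).
    rewrite big_mkcond [leRHS]big_mkcond; apply: ler_sum => d _.
    case: (boolP (_ && _)) => [/andP[d_gt1 _]|_]; last first.
      by case: ifP => // _; rewrite mulr_ge0 ?exprn_ge0.
    rewrite d_gt1.
    have d_gt0 : 0 < d%:R :> R by rewrite ltr0n ltnW.
    have u_gt0 : 0 < d%:R^-1 :> R by rewrite invr_gt0.
    have u_le1 : d%:R^-1 <= 1 :> R by rewrite invf_le1 // ler1n ltnW.
    apply: (@le_trans _ _ (d%:R * (d%:R / K%:R ^+ 2 * d%:R^-1 ^+ 4))).
      rewrite ler_wpM2l // ler_pM ?excess_ge0 ?exprn_ge0 ?excess_led //.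
      by apply: ler_wiXn2l => //; apply: ltW.
    rewrite le_eqVlt; apply/orP; left; apply/eqP; field.
    by rewrite !gt_eqF.
  by rewrite -mulr_sumr -[leRHS]mulr1 ler_wpM2l ?exprn_ge0 ?sum_inv_sqr_le.
apply: (@le_trans _ _ ((m%:R / K%:R ^+ N.+1) `^ tail_exponent R N.+1)); last first.
  by rewrite ler_peMl ?powR_ge0 // ler1n.
apply: (@le_trans _ _ ((K%:R^-1 ^+ N.+1) `^ tail_exponent R N.+1)); last first.
  apply: ge0_ler_powR;
    rewrite ?nnegrE ?exprn_ge0 ?(ltW y_gt0) ?(ltW (tail_exponent_gt0 _ _)) //.
  by rewrite exprVn -[leLHS]mul1r ler_wpM2r ?invr_ge0 ?exprn_ge0 // ler1n.
rewrite -!powR_mulrn ?invr_ge0 // -powRrM; apply: ger_powR; first by rewrite v_gt0.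
rewrite /tail_exponent mulrA ler_pdivrMr ?ltr0n // mulrC ler_wpM2l // ler_nat; lia.
Qed.

Definition density_const (R : realType) (N : nat) : R := 3 * 2 ^+ N.

(** The sum over the frequencies splits by [expr_add_diff] into a sum that is
    grouped by orders, for [divisor_sum_le], and a sum of at most [m] terms
    that are at most [K^(- N)]. For [K ^ N < m] the bound exceeds 1 and holds
    trivially. *)
Lemma uncovered_density (R : realType) (m K N : nat) :
  (0 < m)%N -> (0 < K)%N -> (2 <= N)%N ->
  #|uncovered m K N|%:R / m%:R ^+ N
  <= density_const R N * (m%:R / K%:R ^+ N) `^ tail_exponent R N.
Proof.
move=> m_gt0 K_gt0 N_ge2.
have mR_gt0 : 0 < m%:R :> R by rewrite ltr0n.
have KR_gt0 : 0 < K%:R :> R by rewrite ltr0n.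
have N_gt0 : (0 < N)%N by apply: ltnW.
have y_gt0 : 0 < m%:R / K%:R ^+ N :> R by rewrite divr_gt0 ?exprn_gt0.
have [m_le | m_gt] := leqP m (K ^ N); last first.
  apply: (@le_trans _ _ 1).
    rewrite ler_pdivrMr ?exprn_gt0 // mul1r -natrX ler_nat.
    by apply: leq_trans (max_card _) _; rewrite card_ffun !card_ord.
  have c_ge1 : 1 <= density_const R N.
    by rewrite mulr_ege1 ?ler1n // exprn_ege1 // ler1n.
  apply: mulr_ege1 => //.
  apply: (@le_trans _ _ ((m%:R / K%:R ^+ N) `^ 0)); first by rewrite powRr0.
  apply: ler_powR; last by rewrite ltW ?tail_exponent_gt0.
  by rewrite ler_pdivlMr ?exprn_gt0 // mul1r -natrX ler_nat ltnW.
case: N N_ge2 N_gt0 m_le y_gt0 => // N N_ge1 _ m_le y_gt0.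
have y_le1 : m%:R / K%:R ^+ N.+1 <= 1 :> R.
  by rewrite ler_pdivrMr ?exprn_gt0 // mul1r -natrX ler_nat.
apply: le_trans (uncovered_density_le R N.+1 m_gt0 K_gt0) _.
pose u j : R := (add_order m j)%:R^-1; pose e j : R := excess R K (add_order m j).
apply: (@le_trans _ _ (\sum_(j < m | (0 < j)%N) 2 ^+ N.+1 * (e j * u j ^+ N + e j ^+ N.+1))).
  by apply: ler_sum => j _; rewrite expr_add_diff ?invr_ge0 ?excess_ge0.
rewrite -mulr_sumr /density_const [3 * _]mulrC -mulrA ler_wpM2l ?exprn_ge0 //.
rewrite big_split /= (_ : 3 = 2 + 1); last by ring.
rewrite mulrDl mul1r lerD //.
  apply: le_trans (divisor_sum_le R m_gt0 K_gt0 _ m_le); last by lia.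
  apply: (sum_add_order_le (h := fun d => excess R K d * d%:R^-1 ^+ N)) => // d.
  by rewrite mulr_ge0 ?excess_ge0 ?exprn_ge0 ?invr_ge0.
apply: (@le_trans _ _ (m%:R / K%:R ^+ N.+1)).
  rewrite -exprVn mulr_natl -[X in _ *+ X]card_ord -sumr_const.
  rewrite big_mkcond; apply: ler_sum => j _; case: ifP => _.
    by rewrite lerXn2r ?nnegrE ?excess_ge0 ?invr_ge0 ?excess_leK.
  by rewrite exprn_ge0 ?invr_ge0.
apply: ger1_powR; first by rewrite y_gt0.
by apply: le_trans (tail_exponent_le_half _ _) _ => //; rewrite invf_le1 ?ler1n.
Qed.

(** * From covering boxes to the Frobenius number *)

Lemma primitive_mod_residues (N : nat) (a : 'I_N.+1 -> nat) (j : 'I_N.+1) :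
  gcd_vec a = 1%N ->
  primitive_mod (a j) (fun i : 'I_N => a (lift j i) %% a j)%N.
Proof.
move=> gcd1; apply/forallP => t; apply/implyP => t_gt0.
rewrite -[X in is_true X]negbK negb_exists; apply/negP => /forallP all_dvd.
have : (a j %| t * gcd_vec a)%N.
  rewrite /gcd_vec; apply: (big_ind (fun g => a j %| t * g)%N).
  - by rewrite muln0 dvdn0.
  - by move=> x y dvd_x dvd_y; rewrite muln_gcdr dvdn_gcd dvd_x.
  move=> i _; have [k ->| ->] := unliftP j i; last exact: dvdn_mull.
  by have := all_dvd k; rewrite negbK /dvdn modnMmr.
by rewrite gcd1 muln1 => /(dvdn_leq t_gt0); rewrite leqNgt ltn_ord.
Qed.

(** The class of [b] is shifted by [K] times the sum of the [x i] before
    covering is applied: this turns the differences [z i - z' i] into the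
    nonnegative coefficients [z i + (K - z' i)]. The coefficient of [a j] is
    then the quotient [q], which is nonnegative since [b] is large. *)
Lemma covers_representable (N K T : nat) (a : 'I_N.+1 -> nat) (j : 'I_N.+1)
    (b : int) :
  (0 < a j)%N -> (forall i, a i <= T)%N ->
  covers (a j) K (fun i : 'I_N => a (lift j i) %% a j)%N ->
  (N * (T * (2 * K)))%N%:Z <= b -> ~ nonrepresentable a b.
Proof.
set m := a j; pose x (i : 'I_N) := (a (lift j i) %% m)%N.
move=> m_gt0 a_le cov b_ge nonrep.
have m_gt0' : (0 < m%:Z) by rewrite ltz_nat.
have m_neq0 : m%:Z != 0 by rewrite gt_eqF.
pose c := b - K%:Z * (\sum_(i < N) x i)%N%:Z.
have r_lt : (`|(c %% m)%Z| < m)%N by rewrite -ltz_nat gez0_abs ?modz_ge0 ?ltz_pmod.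
have /forallP/(_ (Ordinal r_lt))/existsP[z /existsP[z' /eqP cong]] := cov.
pose y (i : 'I_N) := (z i + (K - z' i))%N.
pose S := (\sum_(i < N) a (lift j i) * y i)%N.
have S_le : (S <= N * (T * (2 * K)))%N.
  rewrite -[X in (_ <= X * _)%N](card_ord N) -sum_nat_const; apply: leq_sum => i _.
  by rewrite leq_mul //; have := ltn_ord (z i); rewrite /y; lia.
have S_dvd : (m %| b - S%:Z)%Z.
  have -> : b - S%:Z = (c - (c %% m)%Z)
     + ((c %% m)%Z + (dot x (fun i => z' i))%:Z - (dot x (fun i => z i))%:Z)
     - (\sum_(i < N) (a (lift j i) %/ m * m) * y i)%N%:Z.
    have SE : (S + dot x (fun i => z' i) = dot x (fun i => z i)
        + K * \sum_(i < N) x i + \sum_(i < N) (a (lift j i) %/ m * m) * y i)%N.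
      rewrite /S /dot big_distrr -!big_split; apply: eq_bigr => i _ /=.
      rewrite [in LHS](divn_eq (a (lift j i)) m) -/(x i) /y.
      have KE : (K * x i = (K - z' i + z' i) * x i)%N by rewrite subnK // ltnW.
      rewrite KE; move: (a _ %/ m)%N (K - z' i)%N => q w; ring.
    rewrite /c; lia.
  apply: rpredB; first apply: rpredD.
  - apply/dvdzP; exists (c %/ m)%Z; have := divz_eq c m; lia.
  - rewrite -(gez0_abs (modz_ge0 c m_neq0)) -PoszD -eqz_mod_dvd.
    by rewrite !modz_nat; apply/eqP; rewrite cong.
  - rewrite (big_morph Posz PoszD (erefl _)); apply: rpred_sum => i _.
    by rewrite PoszM mulrC dvdz_mull // PoszM dvdz_mull.
have /dvdzP[q bE] := S_dvd.
have q_ge0 : 0 <= q.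
  rewrite -(pmulr_lge0 _ m_gt0') -bE subr_ge0; apply: le_trans b_ge.
  by rewrite lez_nat.
apply: (nonrep (fun i => if unlift j i is Some k then y k else `|q|%N)).
rewrite (bigD1_ord j) //= unlift_none gez0_abs // -/m.
rewrite (eq_bigr (fun i : 'I_N => (a (lift j i) * y i)%N%:Z)); last first.
  by move=> i _; rewrite liftK PoszM.
by rewrite -(big_morph Posz PoszD (erefl _)) mulrC -bE subrK.
Qed.

(** * Dyadic cells *)

Definition in_cell (n T : nat) (k a : {ffun 'I_n -> 'I_T.+1}) : bool :=
  [forall i, 2 ^ k i <= a i < 2 ^ (k i).+1]%N.

Definition residues (N T m : nat) (m_gt0 : (0 < m)%N) (j : 'I_N.+1)
    (a : {ffun 'I_N.+1 -> 'I_T.+1}) : {ffun 'I_N -> 'I_m} :=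
  [ffun i => Ordinal (ltn_pmod (a (lift j i)) m_gt0)].

(** A vector of the cell with [a j = m] is determined by the residues and the
    quotients mod [m] of its other entries. As [k j] is minimal, [m] is less
    than [2 ^ (k i).+1], so there are at most [4 * 2 ^ k i / m] possible
    quotients for [a i]. *)
Lemma card_cell_residues (N T m : nat) (m_gt0 : (0 < m)%N) (j : 'I_N.+1)
    (k : {ffun 'I_N.+1 -> 'I_T.+1}) (B : {set {ffun 'I_N -> 'I_m}}) :
  (forall i, k j <= k i)%N ->
  (#|[set a | [&& in_cell k a, a j == m :> nat & residues m_gt0 j a \in B]]|
     * m ^ N <= #|B| * \prod_(i < N) (4 * 2 ^ k (lift j i)))%N.
Proof.
move=> j_min; set A := [set a | _].
have [->|[a0 a0A]] := set_0Vmem A; first by rewrite cards0.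
have m_lt : (m < 2 ^ (k j).+1)%N.
  by move: a0A; rewrite inE => /and3P[/forallP/(_ j)/andP[_ a_lt] /eqP aj _]; rewrite -aj.
pose c (i : 'I_N) := (2 ^ (k (lift j i)).+1 %/ m)%N.
pose Q := [set q : {ffun 'I_N -> 'I_T.+1} | [forall i, q i <= c i]%N].
have Q_le : (#|Q| <= \prod_(i < N) (c i).+1)%N.
  have -> : #|Q| = #|family (fun i => [pred q : 'I_T.+1 | q <= c i]%N)|.
    by apply: eq_card => q; rewrite inE; apply: eq_forallb => i.
  rewrite card_family foldrE big_map big_enum /=; apply: leq_prod => i _.
  apply: (@leq_trans #|[set (inord v : 'I_T.+1) | v : 'I_(c i).+1]|).
    apply/subset_leq_card/fintype.subsetP => q q_le.
    apply/imsetP; exists (Ordinal (q_le : (q < (c i).+1)%N)) => //=.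
    by apply: val_inj; rewrite /= inordK.
  by apply: leq_trans (leq_imset_card _ _) _; rewrite card_ord.
pose f (a : {ffun 'I_N.+1 -> 'I_T.+1}) : {ffun 'I_N -> 'I_m} * {ffun 'I_N -> 'I_T.+1} :=
  (residues m_gt0 j a, [ffun i => inord (a (lift j i) %/ m)]).
have fq a i : (f a).2 i = (a (lift j i) %/ m)%N :> nat.
  by rewrite ffunE inordK // ltnS (leq_trans (leq_div _ _)) // -ltnS.
have card_A : (#|A| <= #|B| * #|Q|)%N.
  rewrite -cardsX -(card_in_imset (f := f)).
    apply/subset_leq_card/fintype.subsetP => _ /imsetP[a + ->].
    rewrite !inE => /and3P[/forallP cell _ ->]; apply/forallP => i.
    by rewrite fq leq_div2r // ltnW //; case/andP: (cell (lift j i)).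
  move=> a a'; rewrite !inE => /and3P[_ /eqP aj _] /and3P[_ /eqP aj' _] eq_f.
  apply/ffunP => i; apply: val_inj => /=.
  have [i' ->|->] := unliftP j i; last by rewrite aj aj'.
  rewrite (divn_eq (a (lift j i')) m) (divn_eq (a' (lift j i')) m) -!fq eq_f.
  congr addn; have : residues m_gt0 j a i' = residues m_gt0 j a' i'.
    by have -> : residues m_gt0 j a = residues m_gt0 j a' by case: eq_f.
  by rewrite !ffunE => /(congr1 val).
apply: leq_trans (leq_mul card_A (leqnn _)) _; rewrite -mulnA leq_mul2l.
apply/orP; right; apply: leq_trans (leq_mul Q_le (leqnn _)) _.
rewrite -[X in (_ * m ^ X)%N]card_ord -prod_nat_const -big_split /=.
apply: leq_prod => i _; rewrite mulSn /c.
have := leq_trunc_div (2 ^ (k (lift j i)).+1) m.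
have : (2 ^ (k j).+1 <= 2 ^ (k (lift j i)).+1)%N by rewrite leq_pexp2l ?ltnS.
by move: m_lt; rewrite !expnS; lia.
Qed.

Definition tail_event (R : realType) (n T : nat) (D : R)
    (a : {ffun 'I_n -> 'I_T.+1}) : bool :=
  D <= (frobenius_number (fun i => a i))%:~R
         / (\prod_(i < n) (a i)%:R) `^ (1 / (n%:R - 1)).

Lemma tail_event_uncovered (R : realType) (N T K : nat) (D : R)
    (k a : {ffun 'I_N.+1 -> 'I_T.+1}) (j : 'I_N.+1) (m : nat) (m_gt0 : (0 < m)%N) :
  (0 < N)%N -> 0 < D ->
  (N * (T * (2 * K)))%:R <= D * (\prod_i 2 ^ k i)%:R `^ N%:R^-1 ->
  a \in G N.+1 T -> in_cell k a -> a j = m :> nat -> tail_event D a ->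
  residues m_gt0 j a \in uncovered m K N.
Proof.
move=> N_gt0 D_gt0 K_le; rewrite inE => /andP[/forallP a_gt0 /eqP gcd1].
move=> /forallP cell aj tail; rewrite inE.
have -> : (fun i => nat_of_ord (residues m_gt0 j a i))
    = (fun i => a (lift j i) %% m)%N.
  by apply/funext => i; rewrite ffunE.
have := @primitive_mod_residues N (fun i => a i) j gcd1; rewrite /= aj => ->.
apply/negP => cov; rewrite -aj in cov.
have [nonrep _] := frobenius_numberP a_gt0 gcd1.
apply: (@covers_representable N K T (fun i => a i) j _ (a_gt0 j) _ cov _ nonrep) => [i|].
  by rewrite -ltnS.
rewrite -(ler_int R); apply: le_trans K_le _.
have a_prod_gt0 : 0 < \prod_i (a i)%:R :> R.
  by apply: prodr_gt0 => i _; rewrite ltr0n.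
move: tail; rewrite /tail_event.
have -> : N.+1%:R - 1 = N%:R :> R by rewrite mulrSr addrK.
rewrite div1r.
rewrite ler_pdivlMr ?powR_gt0 //; apply: le_trans.
rewrite ler_pM2l //; apply: ge0_ler_powR;
  rewrite ?nnegrE ?invr_ge0 ?ler0n ?(ltW a_prod_gt0) //.
by rewrite -natr_prod ler_nat; apply: leq_prod => i _; case/andP: (cell i).
Qed.

(** * The tail inside a cell *)

(** A bound for the density of the residue vectors that fail to cover with the
    largest box that forces the Frobenius number to be less than [X]. *)
Definition tail_bound (R : realType) (N T : nat) (X : R) : R :=
  density_const R N
    * ((4 * N%:R) ^+ N * (T%:R ^+ N.+1 / X ^+ N)) `^ tail_exponent R N.

(** The box has side [K], the integer part of [kappa = X / (2 N T)]. If [kappa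
    >= 1] then [K >= kappa / 2]; otherwise the bound exceeds 1. *)
Lemma exists_box (R : realType) (N T : nat) (X : R) :
  (2 <= N)%N -> (0 < T)%N -> 0 < X ->
  exists K : nat, (N * (T * (2 * K)))%:R <= X /\
    forall m, (0 < m <= T)%N ->
      #|uncovered m K N|%:R / m%:R ^+ N <= tail_bound N T X.
Proof.
move=> N_ge2 T_gt0 X_gt0; have N_gt0 : (0 < N)%N by apply: ltnW.
have NR_gt0 : 0 < N%:R :> R by rewrite ltr0n.
have TR_gt0 : 0 < T%:R :> R by rewrite ltr0n.
pose kappa : R := X / (2 * N%:R * T%:R).
have kappa_gt0 : 0 < kappa by rewrite divr_gt0 ?mulr_gt0.
have baseE : (4 * N%:R) ^+ N * (T%:R ^+ N.+1 / X ^+ N) = T%:R * (2 / kappa) ^+ N.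
  have -> : 2 / kappa = 4 * N%:R * T%:R / X by rewrite /kappa; field; rewrite !gt_eqF.
  rewrite expr_div_n; move: (4 * N%:R : R) => c; rewrite exprMn [T%:R ^+ N.+1]exprS.
  by rewrite -!mulrA mulrCA.
have base_gt0 : 0 < T%:R * (2 / kappa) ^+ N 
  by apply: mulr_gt0 => //; apply: exprn_gt0; apply: divr_gt0.
have /andP[K_le K_gt] := truncn_itv (ltW kappa_gt0).
set K := Num.truncn kappa in K_le K_gt; exists K; split.
  have -> : (N * (T * (2 * K)))%:R = K%:R * (2 * N%:R * T%:R) :> R.
    by rewrite !natrM; ring.
  by rewrite -ler_pdivlMr ?mulr_gt0.
move=> m /andP[m_gt0 m_le]; rewrite /tail_bound baseE.
have mR_gt0 : 0 < m%:R :> R by rewrite ltr0n.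
have [K0|K_gt0] := posnP K.
  apply: (@le_trans _ _ 1).
    rewrite ler_pdivrMr ?exprn_gt0 // mul1r -natrX ler_nat.
    by apply: leq_trans (max_card _) _; rewrite card_ffun !card_ord.
  apply: mulr_ege1; first by rewrite mulr_ege1 ?ler1n // exprn_ege1 // ler1n.
  apply: (@le_trans _ _ ((T%:R * (2 / kappa) ^+ N) `^ 0)); first by rewrite powRr0.
  apply: ler_powR; last by rewrite ltW ?tail_exponent_gt0.
  rewrite mulr_ege1 ?ler1n // exprn_ege1 // ler_pdivlMr // mul1r.
  by rewrite ltW // (lt_le_trans K_gt) // K0 ler_nat.
apply: le_trans (uncovered_density R m_gt0 K_gt0 N_ge2) _.
rewrite ler_wpM2l ?mulr_ge0 ?exprn_ge0 //.
have KR_gt0 : 0 < K%:R :> R by rewrite ltr0n.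
apply: ge0_ler_powR; rewrite ?nnegrE ?(ltW base_gt0) ?divr_ge0 ?exprn_ge0 //.
have inv_le : K%:R^-1 <= 2 / kappa.
  rewrite ler_pdivlMr // mulrC ler_pdivrMr // (le_trans (ltW K_gt)) //.
  by rewrite -natrM ler_nat; lia.
rewrite -exprVn; apply: ler_pM; rewrite ?exprn_ge0 ?invr_ge0 ?ler_nat //.
have ratio_gt0 : 0 < 2 / kappa by apply: divr_gt0.
by rewrite lerXn2r // nnegrE ?invr_ge0 // ltW.
Qed.

Lemma card_dyadic (T k : nat) :
  (#|[set m : 'I_T.+1 | 2 ^ k <= m < 2 ^ k.+1]| <= 2 ^ k)%N.
Proof.
apply: (@leq_trans #|[set (inord (2 ^ k + v) : 'I_T.+1) | v : 'I_(2 ^ k)]|).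
  apply/subset_leq_card/fintype.subsetP => m; rewrite inE expnS => /andP[m_ge m_lt].
  have v_lt : (m - 2 ^ k < 2 ^ k)%N by lia.
  apply/imsetP; exists (Ordinal v_lt) => //=; apply: val_inj => /=.
  by rewrite subnKC // inordK.
by apply: leq_trans (leq_imset_card _ _) _; rewrite card_ord.
Qed.

(** On the cell the product of the entries is at least [V = prod_i 2 ^ k i],
    so the tail event forces a Frobenius number of at least [D V^(1/N)]; one
    box then serves for all vectors of the cell. The value [m = a j] is fixed
    first, since the residues depend on it. *)
Lemma card_cell_tail (R : realType) (N T : nat) (D : R)
    (k : {ffun 'I_N.+1 -> 'I_T.+1}) :
  (2 <= N)%N -> (0 < T)%N -> 0 < D ->
  #|[set a in G N.+1 T | in_cell k a & tail_event D a]|%:R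
  <= 4 ^+ N * (\prod_i 2 ^ k i)%:R
     * tail_bound N T (D * (\prod_i 2 ^ k i)%:R `^ N%:R^-1).
Proof.
move=> N_ge2 T_gt0 D_gt0; set V := (\prod_i 2 ^ k i)%N.
have V_gt0 : 0 < V%:R :> R.
  by rewrite ltr0n prodn_gt0 // => i; rewrite expn_gt0.
set X := D * _; have X_gt0 : 0 < X by rewrite mulr_gt0 ?powR_gt0.
have [K [K_le dens]] := exists_box N_ge2 T_gt0 X_gt0.
case: (@arg_minnP _ (ord0 : 'I_N.+1) xpredT (fun i => k i : nat) isT) => j _ j_min.
set W := (\prod_(i < N) 2 ^ k (lift j i))%N.
have VE : V = (2 ^ k j * W)%N by rewrite /V (bigD1_ord j).
have rho_ge0 : 0 <= tail_bound N T X.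
  by rewrite mulr_ge0 ?powR_ge0 // mulr_ge0 ?exprn_ge0.
set E := [set a in _ | _].
(* There are at most [2 ^ k j] nonempty slices, and the bound for each of them
   contains the other factors of [V]. *)
have slice (m : 'I_T.+1) : #|[set a in E | a j == m]|%:R
    <= (m \in [set m : 'I_T.+1 | 2 ^ k j <= m < 2 ^ (k j).+1]%N)%:R
       * (4 ^+ N * W%:R * tail_bound N T X).
  have [->|[a0]] := set_0Vmem [set a in E | a j == m].
    by rewrite cards0 mulr_ge0 ?ler0n // mulr_ge0 // mulr_ge0 ?exprn_ge0.
  rewrite !inE => /andP[/and3P[_ /forallP/(_ j) cell0 _] /eqP <-].
  have m_gt0 : (0 < a0 j)%N.
    by case/andP: cell0 => le_a _; apply: leq_trans le_a; rewrite expn_gt0.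
  rewrite cell0 mul1r; set m0 := nat_of_ord (a0 j) in m_gt0 *.
  have mR_gt0 : 0 < m0%:R :> R by rewrite ltr0n.
  have m_le : (0 < m0 <= T)%N by rewrite m_gt0 -ltnS ltn_ord.
  have := card_cell_residues m_gt0 (uncovered m0 K N) (fun i => j_min i isT).
  rewrite big_split prod_nat_const card_ord /= -/W -(ler_nat R) !natrM !natrX => count.
  have sub : #|[set a in E | a j == a0 j]|%:R <= #|[set a : {ffun 'I_N.+1 -> 'I_T.+1} |
     [&& in_cell k a, a j == m0 :> nat & residues m_gt0 j a \in uncovered m0 K N]]|%:R :> R.
    rewrite ler_nat; apply/subset_leq_card/fintype.subsetP => a.
    rewrite !inE -!andbA => /and5P[a_gt0 gcd1 cell tail /eqP aj].
    have aj' : a j = m0 :> nat by rewrite aj.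
    have aG : a \in G N.+1 T by rewrite inE a_gt0.
    have := tail_event_uncovered m_gt0 (ltnW N_ge2) D_gt0 K_le aG cell aj' tail.
    by rewrite cell aj' eqxx inE.
  apply: le_trans sub _; rewrite -(ler_pM2r (exprn_gt0 N mR_gt0)).
  apply: le_trans count _.
  have := dens m0 m_le; rewrite ler_pdivrMr ?exprn_gt0 // => U_le.
  by rewrite -[leRHS]mulrA [leRHS]mulrC ler_wpM2r // mulr_ge0 ?exprn_ge0.
have -> : #|E|%:R = \sum_(m : 'I_T.+1) #|[set a in E | a j == m]|%:R :> R.
  rewrite -natr_sum -sum1_card.
  rewrite (partition_big (fun a : {ffun 'I_N.+1 -> 'I_T.+1} => a j) xpredT) //=.
  congr (_%:R); apply: eq_bigr => m _; rewrite -sum1_card.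
  by apply: eq_bigl => a; rewrite !inE.
apply: le_trans (ler_sum _ (fun m _ => slice m)) _.
rewrite -mulr_suml -natr_sum VE natrM.
move: (tail_bound N T X) rho_ge0 => rho rho_ge0.
have -> : 4 ^+ N * ((2 ^ k j)%N%:R * W%:R) * rho
    = (2 ^ k j)%N%:R * (4 ^+ N * W%:R * rho) by rewrite !mulrA [4 ^+ N * _]mulrC.
rewrite ler_wpM2r ?mulr_ge0 ?exprn_ge0 // ler_nat.
apply: leq_trans (card_dyadic T (k j)).
by rewrite -sum1_card [leqRHS]big_mkcond.
Qed.

(** * Counting coprime vectors and summing over the cells *)

(** A positive vector that is not coprime has all its entries divisible by
    some [d > 1], and [sum_(d > 1) 1/d^n] is at most 1/2. *)
Lemma card_G_ge (R : realType) (n T : nat) : (3 <= n)%N -> (0 < T)%N ->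
  T%:R ^+ n <= 2 * #|G n T|%:R :> R.
Proof.
move=> n_ge3 T_gt0.
have TR_gt0 : 0 < T%:R :> R by rewrite ltr0n.
pose M (d : nat) := [set v : 'I_T.+1 | (0 < v)%N && (d %| v)%N].
pose pos := [set v : 'I_T.+1 | (0 < v)%N].
have card_pos : #|pos| = T.
  rewrite (_ : pos = [set~ ord0]) ?cardsC1 ?card_ord //.
  by apply/setP => v; rewrite !inE -val_eqE /= lt0n.
have card_M d : (0 < d)%N -> (#|M d| <= T %/ d)%N.
  move=> d_gt0.
  apply: (@leq_trans #|[set (inord (u.+1 * d) : 'I_T.+1) | u : 'I_(T %/ d)]|).
    apply/subset_leq_card/fintype.subsetP => v; rewrite inE => /andP[v_gt0 d_dvd].
    have q_gt0 : (0 < v %/ d)%N by rewrite divn_gt0 // dvdn_leq.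
    have u_lt : ((v %/ d).-1 < T %/ d)%N by rewrite prednK // leq_div2r // -ltnS.
    apply/imsetP; exists (Ordinal u_lt) => //=; apply: val_inj => /=.
    by rewrite prednK // divnK // inordK.
  by apply: leq_trans (leq_imset_card _ _) _; rewrite card_ord.
have split : (T ^ n <= #|G n T| + \sum_(d < T.+1 | 1 < d) (T %/ d) ^ n)%N.
  apply: (@leq_trans (#|G n T|
      + \sum_(d < T.+1 | (1 < d)%N) #|ffun_on_mem 'I_n (mem (M d))|)%N); last first.
    rewrite leq_add2l; apply: leq_sum => d d_gt1.
    by rewrite card_ffun_on card_ord leq_exp2r ?card_M ?(ltnW d_gt1) //; lia.
  rewrite -{1}card_pos -{1}(card_ord n) -card_ffun_on.
  rewrite -!sum1_card.
  under [X in (_ <= _ + X)%N]eq_bigr => d _ do rewrite -sum1_card big_mkcond.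
  rewrite exchange_big /= big_mkcond [X in (_ <= X + _)%N]big_mkcond -big_split /=.
  apply: leq_sum => a _; case: ifP => // a_pos; rewrite inE.
  have a_gt0 i : (0 < a i)%N by move/ffun_onP: a_pos => /(_ i); rewrite inE.
  have -> /= : [forall i, (0 < a i)%N] by apply/forallP.
  case: eqVneq => //= gcd_neq1; rewrite add0n.
  have gcd_dvd i : (gcd_vec (fun i => a i) %| a i)%N.
    by rewrite /gcd_vec; apply: (biggcdn_inf i).
  have i0 : 'I_n by apply: (@Ordinal n 0); lia.
  have gcd_le : (gcd_vec (fun i => a i) < T.+1)%N.
    by apply: leq_ltn_trans (dvdn_leq (a_gt0 i0) (gcd_dvd i0)) _.
  have gcd_gt0 : (0 < gcd_vec (fun i => a i))%N by apply: dvdn_gt0 (a_gt0 i0) (gcd_dvd i0).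
  (* A vector that is not coprime is counted at [d] equal to its gcd. *)
  rewrite (bigD1 (Ordinal gcd_le)) /=; last by rewrite ltn_neqAle eq_sym gcd_neq1.
  rewrite ifT //; apply/ffun_onP => i; rewrite inE a_gt0 /=.
  exact: gcd_dvd.
have tail : (\sum_(d < T.+1 | 1 < d) (T %/ d) ^ n)%N%:R <= T%:R ^+ n / 2 :> R.
  rewrite natr_sum.
  apply: (@le_trans _ _ (\sum_(d < T.+1 | (1 < d)%N) T%:R ^+ n / 2 * d%:R^-1 ^+ 2)).
    apply: ler_sum => d d_gt1.
    have d_gt0 : 0 < d%:R :> R by rewrite ltr0n ltnW.
    have u_gt0 : 0 < d%:R^-1 :> R by rewrite invr_gt0.
    have u_le : d%:R^-1 <= 2^-1 :> R by rewrite lef_pV2 ?posrE // ler_nat.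
    rewrite natrX; apply: (@le_trans _ _ ((T%:R * d%:R^-1) ^+ n)).
      rewrite lerXn2r ?nnegrE ?mulr_ge0 ?(ltW u_gt0) //.
      by rewrite ler_pdivlMr // -natrM ler_nat leq_trunc_div.
    rewrite exprMn -mulrA ler_wpM2l ?exprn_ge0 //.
    apply: (@le_trans _ _ (d%:R^-1 ^+ 3)).
      by apply: ler_wiXn2l => //; apply: le_trans u_le _; lra.
    by rewrite exprS ler_wpM2r ?exprn_ge0 ?(ltW u_gt0).
  rewrite -mulr_sumr -[leRHS]mulr1 ler_wpM2l ?sum_inv_sqr_le //.
move: split; rewrite -(ler_nat R) natrD natrX => split; lra.
Qed.

(** A geometric sum of ratio [sqrt 2], hence comparable with its last term,
    which is at most [T]. *)
Lemma sum_dyadic_weight_le (R : realType) (T M : nat) :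
  \sum_(k < M | (2 ^ k <= T)%N) Num.sqrt (T%:R * 2 ^+ k) <= 4 * T%:R :> R.
Proof.
pose s : R := Num.sqrt 2.
have s_sqr : s ^+ 2 = 2 by rewrite sqr_sqrtr.
have s_ge0 : 0 <= s by apply: sqrtr_ge0.
have s_ge : 4 / 3 <= s by nra.
have sqrt_pow k : Num.sqrt (2 ^+ k) = s ^+ k :> R.
  elim: k => [|k IHk]; first by rewrite !expr0 sqrtr1.
  by rewrite !exprS sqrtrM // IHk.
(* The second inequality, a bound by the next term of the series, carries the
   induction. *)
have partial : \sum_(k < M | (2 ^ k <= T)%N) s ^+ k <= 4 * Num.sqrt T%:R
    /\ s * \sum_(k < M | (2 ^ k <= T)%N) s ^+ k <= 4 * s ^+ M.
  elim: M => [|M [IH1 IH2]].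
    by rewrite big_ord0 mulr0 !mulr_ge0 ?sqrtr_ge0.
  rewrite big_mkcond big_ord_recr -big_mkcond /=.
  have pow_ge0 : 0 <= s ^+ M by apply: exprn_ge0.
  have pow_le : (2 ^ M <= T)%N -> s ^+ M <= Num.sqrt T%:R.
    by move=> le_T; rewrite -sqrt_pow ler_sqrt ?ler0n // -natrX ler_nat.
  case: ifP => [/pow_le {}pow_le | _]; rewrite exprS; split; nra.
under eq_bigr => k _ do rewrite sqrtrM // sqrt_pow.
rewrite -mulr_sumr -[in leRHS](sqr_sqrtr (ler0n R T)) expr2 mulrCA.
by rewrite ler_wpM2l ?sqrtr_ge0 //; case: partial.
Qed.

Lemma prod_sqrt (R : rcfType) (n : nat) (f : 'I_n -> R) :
  (forall i, 0 <= f i) -> \prod_i Num.sqrt (f i) = Num.sqrt (\prod_i f i).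
Proof.
move=> f_ge0; apply: (big_rec2 (fun x y => x = Num.sqrt y)); rewrite ?sqrtr1 //.
by move=> i x y _ ->; rewrite sqrtrM.
Qed.

Definition cell_const (R : realType) (N : nat) : R :=
  4 ^+ N * (density_const R N * ((4 * N%:R) ^+ N) `^ tail_exponent R N).

(** The cells have all sizes at most [T], so the ratio [T^(N + 1) / V] is at
    least 1 and its power [tail_exponent <= 1/2] may be replaced by a square
    root; the bound then becomes a product over the coordinates. *)
Lemma cell_weight_le (R : realType) (N T : nat) (D : R)
    (k : {ffun 'I_N.+1 -> 'I_T.+1}) :
  (2 <= N)%N -> (0 < T)%N -> 0 < D -> (forall i, 2 ^ k i <= T)%N ->
  4 ^+ N * (\prod_i 2 ^ k i)%:R
     * tail_bound N T (D * (\prod_i 2 ^ k i)%:R `^ N%:R^-1)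
  <= cell_const R N * D `^ (- (N%:R * tail_exponent R N))
     * \prod_i Num.sqrt (T%:R * 2 ^+ k i).
Proof.
move=> N_ge2 T_gt0 D_gt0 k_le.
have TR_gt0 : 0 < T%:R :> R by rewrite ltr0n.
have NR_gt0 : 0 < N%:R :> R by rewrite ltr0n ltnW.
have -> : (\prod_i 2 ^ k i)%:R = \prod_i 2 ^+ k i :> R.
  by rewrite natr_prod; apply: eq_bigr => i _; rewrite natrX.
rewrite prod_sqrt => [|i]; last by rewrite mulr_ge0 ?exprn_ge0.
rewrite big_split /= prodr_const card_ord.
have V_le : \prod_i 2 ^+ k i <= T%:R ^+ N.+1 :> R.
  rewrite -[X in _ ^+ X]card_ord -prodr_const; apply: ler_prod => i _.
  by rewrite exprn_ge0 // -natrX ler_nat k_le.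
have V_gt0 : 0 < \prod_i 2 ^+ k i :> R by apply: prodr_gt0 => i _; rewrite exprn_gt0.
move: (\prod_i 2 ^+ k i) V_le V_gt0 => V V_le V_gt0.
rewrite /tail_bound [(D * _) ^+ N]exprMn.
have -> : V `^ N%:R^-1 ^+ N = V.
  by rewrite -powR_mulrn ?powR_ge0 // -powRrM mulVf ?gt_eqF // powRr1 // ltW.
have -> : T%:R ^+ N.+1 / (D ^+ N * V) = D `^ (- N%:R) * (T%:R ^+ N.+1 / V).
  by rewrite powRN powR_mulrn ?(ltW D_gt0) // invfM mulrCA.
have ratio_ge1 : 1 <= T%:R ^+ N.+1 / V by rewrite ler_pdivlMr // mul1r.
have ratio_ge0 : 0 <= T%:R ^+ N.+1 / V by apply: le_trans ratio_ge1.
have c_ge0 : 0 <= (4 * N%:R) ^+ N :> R by rewrite exprn_ge0 ?mulr_ge0.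
have rest_ge0 : 0 <= D `^ (- N%:R) * (T%:R ^+ N.+1 / V) by rewrite mulr_ge0 ?powR_ge0.
rewrite (powRM _ c_ge0 rest_ge0) (powRM _ (powR_ge0 _ _) ratio_ge0).
rewrite -powRrM mulNr.
have ratio_le : (T%:R ^+ N.+1 / V) `^ tail_exponent R N
    <= Num.sqrt (T%:R ^+ N.+1 / V).
  rewrite -powR12_sqrt //; apply: ler_powR => //.
  exact: tail_exponent_le_half.
have VE : V * Num.sqrt (T%:R ^+ N.+1 / V) = Num.sqrt (T%:R ^+ N.+1 * V).
  rewrite -[X in X * _](sqr_sqrtr (ltW V_gt0)) expr2 -mulrA -sqrtrM ?(ltW V_gt0) //.
  rewrite mulrCA divff ?gt_eqF // mulr1 -sqrtrM ?(ltW V_gt0) //.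
  by rewrite mulrC.
rewrite -VE /cell_const.
set c := density_const R N; set p := (_ ^+ N) `^ _; set q := D `^ _.
have -> : 4 ^+ N * V * (c * (p * (q * (T%:R ^+ N.+1 / V) `^ tail_exponent R N)))
    = 4 ^+ N * (c * p) * q * (V * (T%:R ^+ N.+1 / V) `^ tail_exponent R N).
  ring.
rewrite ler_wpM2l //; last by rewrite ler_wpM2l // ltW.
rewrite !mulr_ge0 ?powR_ge0 ?exprn_ge0 //.
Qed.

(** The sum over all cells of a product over the coordinates is the power of a
    sum over one coordinate. *)
Lemma card_tail_le (R : realType) (N T : nat) (D : R) :
  (2 <= N)%N -> (0 < T)%N -> 0 < D ->
  #|[set a in G N.+1 T | tail_event D a]|%:R
  <= cell_const R N * D `^ (- (N%:R * tail_exponent R N)) * (4 * T%:R) ^+ N.+1.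
Proof.
move=> N_ge2 T_gt0 D_gt0.
set c := cell_const R N * _.
have c_ge0 : 0 <= c.
  by rewrite !mulr_ge0 ?powR_ge0 ?exprn_ge0 // mulr_ge0 ?exprn_ge0.
pose cells (k : {ffun 'I_N.+1 -> 'I_T.+1}) :=
  [set a in G N.+1 T | in_cell k a & tail_event D a].
pose w (k : nat) : R := if (2 ^ k <= T)%N then Num.sqrt (T%:R * 2 ^+ k) else 0.
have w_ge0 k : 0 <= w k by rewrite /w; case: ifP; rewrite ?sqrtr_ge0.
have cell_le k : #|cells k|%:R <= c * \prod_i w (k i).
  have [->|[a]] := set_0Vmem (cells k).
    by rewrite cards0 mulr_ge0 // prodr_ge0.
  rewrite inE => /andP[_ /andP[/forallP cell _]].
  have k_le i : (2 ^ k i <= T)%N.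
    by case/andP: (cell i) => le_a _; apply: leq_trans le_a _; rewrite -ltnS.
  apply: le_trans (card_cell_tail k N_ge2 T_gt0 D_gt0) _.
  apply: le_trans (cell_weight_le N_ge2 T_gt0 D_gt0 k_le) _.
  rewrite ler_wpM2l // le_eqVlt (eq_bigr (fun i => w (k i))) ?eqxx // => i _.
  by rewrite /w k_le.
apply: (@le_trans _ _ (\sum_k #|cells k|%:R)).
  rewrite -natr_sum ler_nat -sum1_card.
  under [leqRHS]eq_bigr => k _ do rewrite -sum1_card big_mkcond.
  rewrite exchange_big /= big_mkcond; apply: leq_sum => a _; case: ifP => //.
  rewrite inE => /andP[aG tail].
  have a_gt0 i : (0 < a i)%N by move: aG; rewrite inE => /andP[/forallP].
  have log_lt i : (trunc_log 2 (a i) < T.+1)%N.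
    apply: leq_trans (ltn_expl (trunc_log 2 (a i)) (isT : 1 < 2)%N) _.
    by apply: leq_trans (trunc_logP _ (a_gt0 i)) (ltnW (ltn_ord _)).
  rewrite (bigD1 [ffun i => Ordinal (log_lt i)]) //= ifT // inE aG tail andbT /=.
  by apply/forallP => i; rewrite ffunE /= trunc_logP //= trunc_log_ltn.
apply: le_trans (ler_sum _ (fun k _ => cell_le k)) _.
rewrite -mulr_sumr ler_wpM2l //.
rewrite -(bigA_distr_bigA (fun _ k => w (nat_of_ord k))) prodr_const card_ord.
rewrite lerXn2r ?nnegrE ?sumr_ge0 ?mulr_ge0 //.
by rewrite /w -big_mkcond sum_dyadic_weight_le.
Qed.

Theorem theorem1 (R : realType) (n : nat) (hn : (3 <= n)%N) :
  exists C : R, 0 < C /\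
    forall (T : nat) (D : R), (0 < T)%N -> 0 < D ->
      Prob R (fun a : {ffun 'I_n -> 'I_T.+1} =>
        D <= (frobenius_number (fun i => a i))%:~R
             / (\prod_(i < n) (a i)%:R) `^ (1 / (n%:R - 1)))
      <= C * D `^ (- (2 * ((n%:R - 1) / (n%:R + 1)))).
Proof.
case: n hn => // N N_ge2.
have c_gt0 : 0 < cell_const R N.
  have N_gt0 : 0 < N%:R :> R by rewrite ltr0n ltnW.
  by rewrite !mulr_gt0 ?exprn_gt0 // powR_gt0 // exprn_gt0 // mulr_gt0.
exists (2 * 4 ^+ N.+1 * cell_const R N); split.
  by apply: mulr_gt0 => //; rewrite mulr_gt0 ?exprn_gt0.
move=> T D T_gt0 D_gt0.
have -> : 2 * ((N.+1%:R - 1) / (N.+1%:R + 1)) = N%:R * tail_exponent R N.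
  by rewrite /tail_exponent -[N.+1%:R + 1]mulrSr (mulrSr 1 N) addrK; ring.
have TR_gt0 : 0 < T%:R :> R by rewrite ltr0n.
have G_ge := card_G_ge R N_ge2 T_gt0.
have G_gt0 : 0 < #|G N.+1 T|%:R :> R.
  by have : 0 < T%:R ^+ N.+1 :> R by [rewrite exprn_gt0]; lra.
rewrite /Prob ler_pdivrMr //; apply: le_trans (card_tail_le N_ge2 T_gt0 D_gt0) _.
set q := D `^ _; have q_ge0 : 0 <= q by apply: powR_ge0.
have -> : cell_const R N * q * (4 * T%:R) ^+ N.+1
    = 4 ^+ N.+1 * cell_const R N * q * T%:R ^+ N.+1 by rewrite exprMn; ring.
have -> : 2 * 4 ^+ N.+1 * cell_const R N * q * #|G N.+1 T|%:R
    = 4 ^+ N.+1 * cell_const R N * q * (2 * #|G N.+1 T|%:R) by ring.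
rewrite ler_wpM2l // mulr_ge0 // mulr_ge0 ?exprn_ge0 //; exact: ltW.
Qed.
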